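(* Let $R$ be a $K$-algebra with a skew multiplicative $K$-basis $\mathcal{B}$, let $I$ be a skew 2-nomial ideal of $R$, $A=R/I$, and let $\sim_I$ be the skew 2-nomial relation on $\mathcal{B}\cup\{0\}$ determined by $I$. Let $\overline{\mathcal{B}}$ be the image of $\mathcal{B}$ under the canonical surjection $R\to A$, $f\mapsto\bar f=f+I$, and put $\overline{\mathcal{B}}^*=\overline{\mathcal{B}}-\{0\}$. Then: (i) With respect to the inclusion order on subsets of $\overline{\mathcal{B}}^*$, $\overline{\mathcal{B}}^*$ contains a maximal subset, denoted $\overline{\mathcal{B}}^*_{\sim_I}$, with the property that $$\overline{u_1},\overline{u_2}\in\overline{\mathcal{B}}^*_{\sim_I},\ \overline{u_1}\ne\overline{u_2}\ \text{ implies }\ u_1\not\sim_I u_2.$$ (ii) The maximal subset $\overline{\mathcal{B}}^*_{\sim_I}$ of $\overline{\mathcal{B}}^*$ obtained in (i) forms a skew multiplicative $K$-basis for the skew 2-nomial algebra $A$.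
   Context: $K$ is a field, $K^*=K\setminus\{0\}$; a $K$-algebra is a finitely generated associative $K$-algebra with identity $1$; an ideal is a two-sided ideal. A skew multiplicative $K$-basis of a $K$-algebra is a $K$-basis $\mathcal{B}$, consisting of products of powers of the generators, such that for all $u,v\in\mathcal{B}$ either $uv=0$ or $uv=\lambda w$ with $\lambda\in K^*$, $w\in\mathcal{B}$. Elements of $\mathcal{B}$ are called monomials, and elements $v-\lambda u\in R$ with $v,u\in\mathcal{B}$, $\lambda\in K^*$ are called skew 2-nomials. An ideal $I$ of $R$ is a skew 2-nomial ideal if it is generated by monomials and skew 2-nomials; then $R/I$ is called a skew 2-nomial algebra. For an ideal $I$, the skew 2-nomial relation $\sim_I$ on $\mathcal{B}\cup\{0\}$ is the equivalence relation defined by: $v\sim_Iu$ iff there is $\lambda\in K^*$ with $v-\lambda u\in I$. *)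

(* Defs.v *)
From HB Require Import structures.
From mathcomp Require Import all_boot all_algebra.
From mathcomp Require Import boolp classical_sets.

Set Implicit Arguments.
Unset Strict Implicit.
Unset Printing Implicit Defensive.

Import GRing.Theory.
Local Open Scope ring_scope.
Local Open Scope quotient_scope.
Local Open Scope classical_set_scope.

(* [algType] is built on nonzero rings only, whereas R / I is the zero algebra
   when I = R. The hierarchy admits no further join of [pzRingType] and
   [lmodType], so a K-algebra is a possibly zero ring with a ring morphism
   [alg_scalar] from K to its center, and [alg_scalar k * v] is k acting on v. *)
HB.mixin Record PzRing_isAlgebra (K : pzRingType) (V : Type)
    of GRing.PzRing V := {
  scalar_morph : {rmorphism K -> V};
  scalar_central_subproof : forall k x, scalar_morph k * x = x * scalar_morph k
}.

#[short(type="pzAlgType")]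
HB.structure Definition PzAlgebra (K : pzRingType) :=
  {V of PzRing_isAlgebra K V & GRing.PzRing V}.

Definition alg_scalar (K : pzRingType) (V : pzAlgType K) : {rmorphism K -> V} :=
  scalar_morph.
Arguments alg_scalar {K V}.

Lemma alg_scalarC (K : pzRingType) (V : pzAlgType K) (k : K) (x : V) :
  alg_scalar k * x = x * alg_scalar k.
Proof. exact: scalar_central_subproof. Qed.

(* Two-sided ideals; the whole ring is allowed, unlike in [idealr]. *)
HB.mixin Record isTwoSided (R : pzRingType) (S : R -> bool) := {
  two_sided_subproof :
    forall a u, u \in (S : {pred R}) ->
      a * u \in (S : {pred R}) /\ u * a \in (S : {pred R})
}.

#[short(type="twoSidedIdeal")]
HB.structure Definition TwoSidedIdeal (R : pzRingType) :=
  {S of GRing.ZmodClosed R S & isTwoSided R S}.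

Section AlgebraQuotient.
Variables (K : fieldType) (R : pzAlgType K) (I : twoSidedIdeal R).

Lemma two_sidedMl a u : u \in I -> a * u \in I.
Proof. by move=> /(two_sided_subproof a)[]. Qed.

Lemma two_sidedMr a u : u \in I -> u * a \in I.
Proof. by move=> /(two_sided_subproof a)[]. Qed.

Definition algQuot : Type := Quotient.quot I.

HB.instance Definition _ := EqQuotient.on algQuot.
HB.instance Definition _ := GRing.Zmodule.on algQuot.

Definition algQuot_one : algQuot := \pi_algQuot 1.
Definition algQuot_mul := lift_op2 algQuot *%R.

Lemma algQuot_eqP (x y : R) : \pi_algQuot x = \pi_algQuot y <-> x - y \in I.
Proof. by rewrite Quotient.idealrBE; split=> /eqP. Qed.

Lemma algQuot_piD : {morph \pi_algQuot : x y / x + y}.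
Proof. by move=> x y; apply: (Quotient.pi_add I). Qed.

Lemma algQuot_repr (x : R) : repr (\pi_algQuot x) - x \in I.
Proof. by apply/algQuot_eqP; rewrite reprK. Qed.

Lemma algQuot_piM : {morph \pi_algQuot : x y / x * y >-> algQuot_mul x y}.
Proof.
move=> x y; unlock algQuot_mul; apply/esym/algQuot_eqP.
set x' := repr _; set y' := repr _.
have -> : x' * y' - x * y = x' * (y' - y) + (x' - x) * y.
  by rewrite mulrBr mulrBl addrA subrK.
apply: rpredD; first by apply: two_sidedMl; apply: algQuot_repr.
by apply: two_sidedMr; apply: algQuot_repr.
Qed.

Lemma algQuot_mulA : associative algQuot_mul.
Proof.
by move=> x y z; rewrite -[x]reprK -[y]reprK -[z]reprK -!algQuot_piM mulrA.
Qed.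

Lemma algQuot_mul1 : left_id algQuot_one algQuot_mul.
Proof. by move=> x; rewrite -[x]reprK -algQuot_piM mul1r. Qed.

Lemma algQuot_mulr1 : right_id algQuot_one algQuot_mul.
Proof. by move=> x; rewrite -[x]reprK -algQuot_piM mulr1. Qed.

Lemma algQuot_mulDl : left_distributive algQuot_mul +%R.
Proof.
move=> x y z; rewrite -[x]reprK -[y]reprK -[z]reprK.
by rewrite -algQuot_piD -!algQuot_piM -algQuot_piD mulrDl.
Qed.

Lemma algQuot_mulDr : right_distributive algQuot_mul +%R.
Proof.
move=> x y z; rewrite -[x]reprK -[y]reprK -[z]reprK.
by rewrite -algQuot_piD -!algQuot_piM -algQuot_piD mulrDr.
Qed.

HB.instance Definition _ := GRing.Zmodule_isPzRing.Build algQuot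
  algQuot_mulA algQuot_mul1 algQuot_mulr1 algQuot_mulDl algQuot_mulDr.

Definition canon_surj (x : R) : algQuot := \pi_algQuot x.

Lemma canon_surj_is_zmod_morphism : zmod_morphism canon_surj.
Proof.
move=> x y; apply: (addIr (canon_surj y)).
by rewrite subrK /canon_surj -algQuot_piD subrK.
Qed.

Lemma canon_surj_is_monoid_morphism : monoid_morphism canon_surj.
Proof. by split=> //; exact: algQuot_piM. Qed.

HB.instance Definition _ := GRing.isZmodMorphism.Build R algQuot canon_surj
  canon_surj_is_zmod_morphism.
HB.instance Definition _ := GRing.isMonoidMorphism.Build R algQuot canon_surj
  canon_surj_is_monoid_morphism.

Lemma canon_surjP (y : algQuot) : exists x, canon_surj x = y.
Proof. by exists (repr y); rewrite /canon_surj reprK. Qed.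

Lemma canon_surj_eq0 (x : R) : canon_surj x = 0 <-> x \in I.
Proof. by rewrite -(rmorph0 canon_surj) algQuot_eqP subr0. Qed.

Definition algQuot_scalar : {rmorphism K -> algQuot} :=
  canon_surj \o (alg_scalar : {rmorphism K -> R}).

Lemma algQuot_scalarC k x : algQuot_scalar k * x = x * algQuot_scalar k.
Proof. by have [y <-] := canon_surjP x; rewrite /= -!rmorphM alg_scalarC. Qed.

HB.instance Definition _ :=
  PzRing_isAlgebra.Build K algQuot algQuot_scalarC.

Lemma canon_surj_scalar k : canon_surj (alg_scalar k) = alg_scalar k.
Proof. by []. Qed.

End AlgebraQuotient.

Arguments canon_surj {K R} I x.

Section SkewMultiplicativeBases.
Variables (K : fieldType) (R : pzAlgType K).

Definition lin_indep (B : set R) : Prop :=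
  forall (s : seq R) (c : R -> K), uniq s -> {in s, forall v, B v} ->
    \sum_(v <- s) alg_scalar (c v) * v = 0 -> {in s, forall v, c v = 0}.

Definition spanning (B : set R) : Prop :=
  forall x, exists (s : seq R) (c : R -> K),
    {in s, forall v, B v} /\ x = \sum_(v <- s) alg_scalar (c v) * v.

Definition K_basis (B : set R) : Prop := lin_indep B /\ spanning B.

Definition subalgebra (S : set R) : Prop :=
  [/\ S 1, forall (k : K) x y, S x -> S y -> S (alg_scalar k * x + y)
    & forall x y, S x -> S y -> S (x * y)].

Definition algebra_generators (n : nat) (a : 'I_n -> R) : Prop :=
  forall S : set R, subalgebra S -> (forall i, S (a i)) -> S = setT.

(* Generators may recur, as they need not commute; 1 is the empty product. *)
Definition power_product (n : nat) (a : 'I_n -> R) (u : R) : Prop :=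
  exists w : seq ('I_n * nat), u = \prod_(p <- w) a p.1 ^+ p.2.

Record skew_mult_basis (n : nat) (a : 'I_n -> R) (B : set R) : Prop := {
  smb_generators : algebra_generators a;
  smb_basis : K_basis B;
  smb_power_product : forall u, B u -> power_product a u;
  smb_mul : forall u v, B u -> B v ->
    u * v = 0 \/
    exists (l : K) (w : R), [/\ l != 0, B w & u * v = alg_scalar l * w]
}.

Definition skew_2nomial (B : set R) (f : R) : Prop :=
  exists (v u : R) (l : K), [/\ B v, B u, l != 0 & f = v - alg_scalar l * u].

Definition generated_by (G : set R) (I : twoSidedIdeal R) : Prop :=
  forall x, x \in I <->
    forall J : twoSidedIdeal R, (forall g, G g -> g \in J) -> x \in J.

Definition skew_2nomial_ideal (B : set R) (I : twoSidedIdeal R) : Prop :=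
  exists G : set R, G `<=` B `|` skew_2nomial B /\ generated_by G I.

Definition skew_2nomial_rel (B : set R) (I : twoSidedIdeal R) (v u : R) :
    Prop :=
  [/\ (B `|` [set 0]) v, (B `|` [set 0]) u
    & exists l : K, l != 0 /\ v - alg_scalar l * u \in I].

Definition image_basis (B : set R) (I : twoSidedIdeal R) : set (algQuot I) :=
  [set canon_surj I u | u in B].
Arguments image_basis : clear implicits.

Definition image_basis_star (B : set R) (I : twoSidedIdeal R) :
    set (algQuot I) :=
  image_basis B I `\ 0.
Arguments image_basis_star : clear implicits.

Definition pairwise_unrelated (B : set R) (I : twoSidedIdeal R)
    (S : set (algQuot I)) : Prop :=
  forall u1 u2, B u1 -> B u2 ->
    S (canon_surj I u1) -> S (canon_surj I u2) ->
    canon_surj I u1 <> canon_surj I u2 ->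
    ~ skew_2nomial_rel B I u1 u2.

Definition maximal_unrelated (B : set R) (I : twoSidedIdeal R)
    (S : set (algQuot I)) : Prop :=
  [/\ S `<=` image_basis_star B I, pairwise_unrelated B S
    & forall T : set (algQuot I), T `<=` image_basis_star B I ->
        pairwise_unrelated B T -> S `<=` T -> T = S].

End SkewMultiplicativeBases.

Arguments image_basis {K R} B I.
Arguments image_basis_star {K R} B I.

(* Main.v *)
(* A nonzero monomial image y determines a function [line_coef y] on A, sending
   k y to k and every element off the line K y to 0; it is homogeneous, so
   [line_coef y] composed with the canonical surjection extends from B to a
   linear functional phi on R that agrees with it on all scalar multiples of
   monomials. For monomials u, v and a generator g of I (a monomial or a skew
   2-nomial), u g v is a difference of two such multiples with the same image
   in A (one of them 0 when g is a monomial), so phi kills it. Hence phi kills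
   I, and it reads off the coefficient of y in any combination of pairwise
   non-proportional images: these are linearly independent. *)

Require Import Defs.
From HB Require Import structures.
From mathcomp Require Import all_boot all_algebra.
From mathcomp Require Import boolp classical_sets.

Set Implicit Arguments.
Unset Strict Implicit.
Unset Printing Implicit Defensive.

Import GRing.Theory.
Local Open Scope ring_scope.
Local Open Scope classical_set_scope.

(** * Coordinates along a line of an algebra *)

Section LineCoefficient.
Variables (K : fieldType) (A : pzAlgType K).
Implicit Types (x y : A) (k l : K).

Lemma alg_scalarA k l x : alg_scalar k * (alg_scalar l * x) = alg_scalar (k * l) * x.
Proof. by rewrite mulrA -rmorphM. Qed.

Lemma alg_scalarK k x : k != 0 -> alg_scalar k^-1 * (alg_scalar k * x) = x.
Proof. by move=> k0; rewrite alg_scalarA mulVf// rmorph1 mul1r. Qed.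

Lemma alg_scalar_eq0 k x : x != 0 -> alg_scalar k * x = 0 -> k = 0.
Proof.
move=> x0 kx0; apply/eqP; apply: contraNT x0 => k0.
by rewrite -(alg_scalarK x k0) kx0 mulr0.
Qed.

(** The default 0 of [xget] is the intended value off the line K y; on the line, the scalar is
    unique once y is nonzero. *)
Definition line_coef y x : K := xget 0 [set k | x = alg_scalar k * y].

Lemma line_coef_scale y k : y != 0 -> line_coef y (alg_scalar k * y) = k.
Proof.
move=> y0; rewrite /line_coef; case: xgetP => [l _ /= e|/(_ k)/=]; last by case.
apply/eqP; rewrite eq_sym -subr_eq0; apply/eqP/(alg_scalar_eq0 y0).
by rewrite rmorphB mulrBl e subrr.
Qed.

Lemma line_coef_off y x : (forall k, x <> alg_scalar k * y) -> line_coef y x = 0.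
Proof. by move=> xy; rewrite /line_coef xgetPN. Qed.

Lemma line_coef0 y : y != 0 -> line_coef y 0 = 0.
Proof. by move=> y0; rewrite -(line_coef_scale 0 y0) rmorph0 mul0r. Qed.

(** A nonzero scalar preserves both the line K y and its complement. Additivity fails in general, so
    only homogeneity is available. *)
Lemma line_coefZ y k x : y != 0 -> line_coef y (alg_scalar k * x) = k * line_coef y x.
Proof.
move=> y0; have [->|k0] := eqVneq k 0.
  by rewrite rmorph0 !mul0r line_coef0.
have [[l ->]|xy] := pselect (exists l, x = alg_scalar l * y).
  by rewrite alg_scalarA !line_coef_scale.
rewrite !line_coef_off ?mulr0// => l e; apply: xy; first by exists l.
by exists (k^-1 * l); rewrite -alg_scalarA -e alg_scalarK.
Qed.

End LineCoefficient.

(** * Linear functionals with prescribed values on a basis *)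

Section LinearExtension.
Variables (K : fieldType) (R : pzAlgType K) (B : set R).

(* Lists of (coefficient, vector) pairs allow repeated vectors, so that sums of
   two combinations are concatenations. *)
Definition lin_comb (p : seq (K * R)) : R := \sum_(q <- p) alg_scalar q.1 * q.2.

(** Merges repeated vectors, since [lin_indep] speaks of duplicate-free lists. *)
Definition collect (p : seq (K * R)) (v : R) : K := \sum_(q <- p | q.2 == v) q.1.

Lemma big_fibres (V : nmodType) (T J : eqType) (r : seq T) (h : T -> J)
    (F : T -> V) :
  \sum_(q <- r) F q =
  \sum_(v <- undup (map h r)) \sum_(q <- r | h q == v) F q.
Proof.
rewrite (exchange_big_dep xpredT)//= big_seq [RHS]big_seq.
apply: eq_bigr => q qr; rewrite -big_filter (eq_filter (a2 := pred1 (h q))).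
  by rewrite filter_pred1_uniq ?undup_uniq ?mem_undup ?map_f// big_seq1.
by move=> v; rewrite /= eq_sym.
Qed.

Lemma lin_comb_collect (p : seq (K * R)) :
  lin_comb p = \sum_(v <- undup (map snd p)) alg_scalar (collect p v) * v.
Proof.
rewrite /lin_comb (big_fibres _ snd); apply: eq_bigr => v _.
by rewrite raddf_sum mulr_suml; apply: eq_bigr => q /eqP <-.
Qed.

Lemma undup_snd_sub (p : seq (K * R)) : {in p, forall q, B q.2} ->
  {in undup (map snd p), forall v, B v}.
Proof. by move=> pB v; rewrite mem_undup => /mapP[q qp ->]; exact: pB. Qed.

Lemma spanning_comb :
  (forall x, exists p, {in p, forall q, B q.2} /\ x = lin_comb p) -> spanning B.
Proof.
move=> spB x; have [p [pB ->]] := spB x.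
exists (undup (map snd p)), (collect p); split; first exact: undup_snd_sub.
exact: lin_comb_collect.
Qed.

(** This makes linear extension well defined: every collected coefficient vanishes, and the
    evaluation regroups into collected coefficients times values of f. *)
Lemma lin_indep_comb (f : R -> K) (p : seq (K * R)) : lin_indep B ->
  {in p, forall q, B q.2} -> lin_comb p = 0 -> \sum_(q <- p) q.1 * f q.2 = 0.
Proof.
move=> liB pB; rewrite lin_comb_collect => p0.
have c0 := liB _ _ (undup_uniq _) (undup_snd_sub pB) p0.
rewrite (big_fibres _ snd) big_seq big1// => v /c0 cv0.
transitivity (collect p v * f v); last by rewrite cv0 mul0r.
by rewrite mulr_suml; apply: eq_bigr => q /eqP <-.
Qed.

(** Each x gets a chosen expansion [p x], which is evaluated through f. The value does not depend on
    the choice, so scaled or concatenated expansions may replace the chosen ones. *)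
Lemma linear_extension (f : R -> K) : K_basis B ->
  exists phi : {additive R -> K},
    (forall k x, phi (alg_scalar k * x) = k * phi x) /\
    (forall v, B v -> phi v = f v).
Proof.
move=> [liB spB].
have /choice[p pP] x : exists p : seq (K * R),
    {in p, forall q, B q.2} /\ x = lin_comb p.
  have [s [c [sB ->]]] := spB x.
  exists [seq (c v, v) | v <- s]; rewrite /lin_comb big_map; split=> //.
  by move=> q /mapP[v vs ->]; exact: sB.
pose ev (r : seq (K * R)) := \sum_(q <- r) q.1 * f q.2.
pose scale k (r : seq (K * R)) := [seq (k * q.1, q.2) | q <- r].
have scaleB k r : {in r, forall q, B q.2} -> {in scale k r, forall q, B q.2}.
  by move=> rB q /mapP[q' q'r ->]; exact: (rB q').
have ev_scale k r : ev (scale k r) = k * ev r.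
  rewrite /ev big_map mulr_sumr; apply: eq_bigr => q _ /=; exact/esym/mulrA.
have comb_scale k r : lin_comb (scale k r) = alg_scalar k * lin_comb r.
  rewrite /lin_comb big_map mulr_sumr; apply: eq_bigr => q _ /=.
  by rewrite alg_scalarA.
have catB r t : {in r, forall q, B q.2} -> {in t, forall q, B q.2} ->
    {in r ++ t, forall q, B q.2}.
  by move=> rB tB q; rewrite mem_cat => /orP[/rB|/tB].
(* The difference of two expansions of one element is a linear relation on B. *)
have ev_uniq r t : {in r, forall q, B q.2} -> {in t, forall q, B q.2} ->
    lin_comb r = lin_comb t -> ev r = ev t.
  move=> rB tB e; apply/eqP; rewrite -subr_eq0; apply/eqP.
  have : ev (r ++ scale (-1) t) = 0.
    apply: lin_indep_comb => //; first by apply: catB => //; exact: scaleB.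
    rewrite /lin_comb big_cat /= -!/(lin_comb _) comb_scale.
    by rewrite rmorphN1 mulN1r e subrr.
  by rewrite /ev big_cat /= -!/(ev _) ev_scale mulN1r.
pose phi x := ev (p x).
have phiZ k x : phi (alg_scalar k * x) = k * phi x.
  have [pB xE] := pP x; have [pB' xE'] := pP (alg_scalar k * x).
  rewrite -ev_scale; apply: ev_uniq => //; first exact: scaleB.
  by rewrite comb_scale -xE -xE'.
have phiB : zmod_morphism phi.
  move=> x y; have [xB xE] := pP x; have [yB yE] := pP y.
  have [zB zE] := pP (x - y).
  have -> : phi x - phi y = ev (p x ++ scale (-1) (p y)).
    by rewrite /ev big_cat /= -!/(ev _) ev_scale mulN1r.
  apply: ev_uniq => //; first by apply: catB => //; exact: scaleB.
  rewrite -zE /lin_comb big_cat /= -!/(lin_comb _) comb_scale.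
  by rewrite rmorphN1 mulN1r -xE -yE.
pose phiM := GRing.isZmodMorphism.Build R K phi phiB.
pose phiA : {additive R -> K} := HB.pack phi phiM.
exists phiA; split=> [//|v Bv]; rewrite -[phiA v]/(phi v).
have [vB vE] := pP v.
have -> : f v = ev [:: (1, v)] by rewrite /ev big_seq1 mul1r.
apply: ev_uniq => //; first by move=> q; rewrite inE => /eqP ->.
by rewrite -vE /lin_comb big_seq1 rmorph1 mul1r.
Qed.

End LinearExtension.

(** * The largest two-sided ideal inside the kernel of a functional *)

Section AnnihilatedIdeal.
Variables (K : fieldType) (R : pzAlgType K) (phi : {additive R -> K}).

(** Multiplying on both sides turns the kernel of phi, a mere subgroup, into an ideal against which
    [generated_by] can be tested. *)
Definition annihilated : R -> bool :=
  fun x => `[< forall y z, phi (y * x * z) = 0 >].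

Lemma annihilated_zmod_closed : zmod_closed (annihilated : {pred R}).
Proof.
split=> [|x x']; first by apply/asboolP => y z; rewrite mulr0 mul0r raddf0.
move=> /asboolP xJ /asboolP x'J; apply/asboolP => y z.
by rewrite mulrBr mulrBl raddfB xJ x'J subrr.
Qed.

Lemma annihilated_two_sided (a u : R) : u \in (annihilated : {pred R}) ->
  a * u \in (annihilated : {pred R}) /\ u * a \in (annihilated : {pred R}).
Proof.
move=> /asboolP uJ; split; apply/asboolP => y z; first by rewrite mulrA uJ.
by rewrite mulrA -mulrA uJ.
Qed.

HB.instance Definition _ :=
  GRing.isZmodClosed.Build R annihilated annihilated_zmod_closed.
HB.instance Definition _ := isTwoSided.Build R annihilated annihilated_two_sided.

End AnnihilatedIdeal.

(** * Monomials modulo a skew 2-nomial ideal *)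

Section QuotientBasis.
Variables (K : fieldType) (R : pzAlgType K) (n : nat) (a : 'I_n -> R).
Variables (B : set R) (hB : skew_mult_basis a B) (I : twoSidedIdeal R).

Lemma canon_surjZ k x : canon_surj I (alg_scalar k * x) = alg_scalar k * canon_surj I x.
Proof. by rewrite rmorphM /= canon_surj_scalar. Qed.

Lemma generator_mem G : generated_by G I -> forall g, G g -> g \in I.
Proof. by move=> GI g Gg; apply/GI => J; apply. Qed.

(** The scalar may be 0, which gives closure under products even when two monomials multiply to
    0. *)
Definition monomial_multiple (x : R) : Prop :=
  exists k w, B w /\ x = alg_scalar k * w.

Lemma monomial_multipleM x y :
  monomial_multiple x -> monomial_multiple y -> monomial_multiple (x * y).
Proof.
move=> [k [u [Bu ->]]] [l [v [Bv ->]]].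
have -> : alg_scalar k * u * (alg_scalar l * v) = alg_scalar (k * l) * (u * v).
  by rewrite rmorphM !mulrA -(mulrA _ u) -(alg_scalarC l u) !mulrA.
have [->|[m [w [_ Bw ->]]]] := smb_mul hB Bu Bv.
  by exists 0, u; rewrite rmorph0 mul0r mulr0.
by exists (k * l * m), w; rewrite alg_scalarA.
Qed.

Lemma monomial_multipleZ k u : B u -> monomial_multiple (alg_scalar k * u).
Proof. by exists k, u. Qed.

Lemma monomial_multiple1 u : B u -> monomial_multiple u.
Proof. by exists 1, u; rewrite rmorph1 mul1r. Qed.

Lemma line_functional (y : algQuot I) :
  skew_2nomial_ideal B I -> y != 0 ->
  exists phi : {additive R -> K}, (forall x, x \in I -> phi x = 0) /\
    (forall x, monomial_multiple x -> phi x = line_coef y (canon_surj I x)).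
Proof.
move=> [G [GB GI]] y0.
have [phi [phiZ phiB]] :=
  linear_extension (fun v => line_coef y (canon_surj I v)) (smb_basis hB).
have phiE x : monomial_multiple x -> phi x = line_coef y (canon_surj I x).
  by move=> [k [w [Bw ->]]]; rewrite phiZ phiB// canon_surjZ line_coefZ.
(* It suffices that [annihilated phi] contains the generators: it then contains I, and taking 1 for
   both outer factors gives phi x = 0. *)
exists phi; split=> // x /GI/(_ (TwoSidedIdeal.clone R (annihilated phi) _)) xJ.
suff /xJ/asboolP/(_ 1 1) : forall g, G g -> g \in annihilated phi.
  by rewrite mul1r mulr1.
move=> g Gg; have gI := generator_mem GI Gg; apply/asboolP => u v.
have [_ spB] := smb_basis hB.
(* By additivity, the outer factors reduce to scalar multiples of monomials. *)
have [s [c [sB ->]]] := spB u; have [t [d [tB ->]]] := spB v.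
rewrite !mulr_suml raddf_sum big_seq big1//= => {}u /sB Bu.
rewrite mulr_sumr raddf_sum big_seq big1//= => {}v /tB Bv.
have : alg_scalar (c u) * u * g * (alg_scalar (d v) * v) \in I.
  by apply/two_sidedMr/two_sidedMl.
have := monomial_multipleZ (d v) Bv; have := monomial_multipleZ (c u) Bu.
move: (_ * u) (_ * v) => {Bu}{}u {Bv}{}v Mu Mv.
have uwvM w : monomial_multiple w -> monomial_multiple (u * w * v).
  by move=> Mw; apply/monomial_multipleM => //; exact: monomial_multipleM.
case: (GB _ Gg) => [/monomial_multiple1 Bg|[w [w' [l [Bw Bw' l0 ->]]]]].
  by move=> /canon_surj_eq0 ugv0; rewrite phiE ?ugv0 ?line_coef0//; exact: uwvM.
rewrite mulrBr mulrBl raddfB/= => /algQuot_eqP e.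
rewrite !phiE; [|by apply: uwvM; exists l, w'|exact/uwvM/monomial_multiple1].
by rewrite /canon_surj e subrr.
Qed.

(** In A, two monomials are related exactly when their images are proportional. The scalar 0 is
    harmless on the right, as elements of S are nonzero. *)
Lemma pairwise_unrelatedP (S : set (algQuot I)) : S `<=` image_basis_star B I ->
  pairwise_unrelated B S <->
  (forall x y, S x -> S y -> x <> y -> forall l, x <> alg_scalar l * y).
Proof.
move=> SB; split=> [un x y Sx Sy xy l xly|un u1 u2 Bu1 Bu2 S1 S2 u12].
  have [[u1 Bu1 u1x] x0] := SB _ Sx; have [[u2 Bu2 u2y] y0] := SB _ Sy.
  apply: (un u1 u2) => //; rewrite ?u1x ?u2y//.
  split; [by left|by left|exists l; split].
    by apply/eqP => l0; apply: x0; rewrite xly l0 rmorph0 mul0r.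
  by apply/canon_surj_eq0; rewrite rmorphB /= canon_surjZ u1x u2y xly subrr.
move=> [_ _ [l [_ /canon_surj_eq0]]]; rewrite rmorphB /= canon_surjZ.
by move/eqP; rewrite subr_eq0 => /eqP/(un _ _ S1 S2 u12).
Qed.

(** Taken as a set so that proportional elements have equal classes, from which [xget] picks the
    same representative. *)
Definition proportional (x : algQuot I) : set (algQuot I) :=
  [set y | image_basis_star B I y /\ exists l : K, l != 0 /\ y = alg_scalar l * x].

Lemma proportional_scale (x : algQuot I) l :
  l != 0 -> proportional (alg_scalar l * x) = proportional x.
Proof.
move=> l0; apply/seteqP; split=> y [By [k [k0 yE]]].
  by split=> //; exists (k * l); rewrite mulf_neq0// yE alg_scalarA.
split=> //.
by exists (k / l); rewrite yE alg_scalarA divfK// mulf_neq0// invr_eq0.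
Qed.

(** Zorn's lemma is avoided: S takes one chosen representative from each proportionality class. Any
    x in an unrelated T containing S is proportional to its representative, which also lies in T, so
    the two coincide. *)
Lemma exists_maximal_unrelated : exists S : set (algQuot I), maximal_unrelated B S.
Proof.
pose rep x := xget 0 (proportional x).
have repP x : image_basis_star B I x -> proportional x (rep x).
  move=> Bx; apply: (xgetPex 0); exists x; split=> //.
  by exists 1; rewrite oner_neq0 rmorph1 mul1r.
pose S := [set x | image_basis_star B I x /\ rep x = x].
have SB : S `<=` image_basis_star B I by move=> x [].
exists S; split=> //.
  apply/pairwise_unrelatedP => // x y [Bx rx] [By ry] xy l xly; apply: xy.
  rewrite -rx -ry /rep xly proportional_scale//.
  by apply/eqP => l0; apply: Bx.2; rewrite xly l0 rmorph0 mul0r.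
move=> T TB /(pairwise_unrelatedP TB) unT ST; apply/seteqP; split=> // x Tx.
have Bx := TB _ Tx; have [Brx [l [l0 rxE]]] := repP x Bx.
split=> //; apply: contrapT => rxx; apply: (unT (rep x) x _ Tx rxx l) => //.
(* [rep x] lies in S because [rep] is constant on classes, hence idempotent. *)
by apply: ST; split=> //; rewrite {1}rxE {1}/rep proportional_scale.
Qed.

(** Otherwise y could be adjoined to S without creating proportional pairs; maximality would put y
    in S, yet y = 1 y. *)
Lemma maximal_unrelated_cover (S : set (algQuot I)) : maximal_unrelated B S ->
  forall y, image_basis_star B I y ->
  exists l x, [/\ l != 0, S x & y = alg_scalar l * x].
Proof.
move=> [SB /(pairwise_unrelatedP SB) unS maxS] y By; apply: contrapT => ny.
have nSy k x : S x -> y <> alg_scalar k * x.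
  move=> Sx yE; apply: ny; exists k, x; split=> //.
  by apply/eqP => k0; apply: By.2; rewrite yE k0 rmorph0 mul0r.
have nyS k x : S x -> x <> alg_scalar k * y.
  move=> Sx xE; have k0 : k != 0.
    by apply/eqP => k0; apply: (SB _ Sx).2; rewrite xE k0 rmorph0 mul0r.
  by apply: (nSy k^-1 x Sx); rewrite xE alg_scalarK.
have TB : S `|` [set y] `<=` image_basis_star B I by move=> x [/SB|->].
have /(maxS _ TB) ST : pairwise_unrelated B (S `|` [set y]).
  apply/pairwise_unrelatedP => // x z [Sx|->] [Sz|->] xz k //.
  - exact: unS.
  - exact: nyS.
  - exact: nSy.
have Sy : S y by rewrite -ST; [right|left].
by apply: (nSy 1 y Sy); rewrite rmorph1 mul1r.
Qed.

(** A relation in A lifts to an element of I by choosing monomial preimages. The functional attached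
    to y kills it and, by non-proportionality, every term but that of y, leaving c y = 0. *)
Lemma unrelated_lin_indep (S : set (algQuot I)) :
  skew_2nomial_ideal B I -> S `<=` image_basis_star B I ->
  pairwise_unrelated B S -> lin_indep S.
Proof.
move=> hI SB /(pairwise_unrelatedP SB) unS s c us sS s0 y ys.
have Sy := sS _ ys; have y0 : y != 0 by apply/eqP; exact: (SB _ Sy).2.
have /choice[r rP] x : exists u, S x -> B u /\ canon_surj I u = x.
  have [Sx|nSx] := pselect (S x); last by exists 0.
  by have [[u Bu ux] _] := SB _ Sx; exists u.
have [phi [phiI phiE]] := line_functional hI y0.
have /phiI : \sum_(x <- s) alg_scalar (c x) * r x \in I.
  apply/canon_surj_eq0; rewrite rmorph_sum -[RHS]s0 big_seq [RHS]big_seq.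
  by apply: eq_bigr => x /sS Sx /=; rewrite canon_surjZ (rP _ Sx).2.
rewrite raddf_sum (bigD1_seq y)//= big_seq_cond big1 => [|x /andP[/sS Sx /eqP xy]].
  have [By ry] := rP _ Sy; rewrite addr0 phiE; last exact: monomial_multipleZ.
  by rewrite canon_surjZ ry line_coef_scale.
have [Bx rx] := rP _ Sx; rewrite phiE; last exact: monomial_multipleZ.
by rewrite canon_surjZ rx line_coefZ// line_coef_off ?mulr0//; exact: unS.
Qed.

(** A preimage is expanded in B and each monomial image is 0 or a multiple of a member of S. Several
    monomials may hit the same member, hence the lists with repetition. *)
Lemma maximal_unrelated_spanning (S : set (algQuot I)) :
  maximal_unrelated B S -> spanning S.
Proof.
move=> maxS; apply: spanning_comb => y; have [x <-] := canon_surjP y.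
have [s [c [sB ->]]] := (smb_basis hB).2 x.
rewrite rmorph_sum /= big_seq.
apply: (big_ind (fun z => exists p, {in p, forall q, S q.2} /\ z = lin_comb p))
  => [|u v [p [pS ->]] [q [qS ->]]|v /sB Bv].
- by exists [::]; rewrite /lin_comb big_nil.
- exists (p ++ q); rewrite /lin_comb big_cat; split=> // r.
  by rewrite mem_cat => /orP[/pS|/qS].
rewrite canon_surjZ; have [->|v0] := eqVneq (canon_surj I v) 0.
  by exists [::]; rewrite /lin_comb big_nil mulr0.
have [|l [z [l0 Sz ->]]] := maximal_unrelated_cover maxS (y := canon_surj I v).
  by split; [exists v|exact/eqP].
exists [:: (c v * l, z)]; rewrite /lin_comb big_seq1 alg_scalarA; split=> // q.
by rewrite inE => /eqP ->.
Qed.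

(** The preimage of a subalgebra of A is a subalgebra of R. *)
Lemma canon_surj_generators : algebra_generators (fun i => canon_surj I (a i)).
Proof.
move=> S [S1 SD SM] Sa; apply/seteqP; split=> // y _.
have [x <-] := canon_surjP y.
suff : [set x | S (canon_surj I x)] x by [].
rewrite (smb_generators hB (S := [set x | S (canon_surj I x)]))//.
split=> /= [|k u v Su Sv|u v Su Sv]; first by rewrite rmorph1.
- by rewrite rmorphD /= canon_surjZ; exact: SD.
- by rewrite rmorphM; exact: SM.
Qed.

End QuotientBasis.

(** * The skew multiplicative basis of the quotient algebra *)

Theorem theorem3p4 (K : fieldType) (R : pzAlgType K) (n : nat)
    (a : 'I_n -> R) (B : set R) (hB : skew_mult_basis a B)
    (I : twoSidedIdeal R) (hI : skew_2nomial_ideal B I) :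
  (exists S : set (algQuot I), maximal_unrelated B S) /\
  (forall S : set (algQuot I), maximal_unrelated B S ->
     skew_mult_basis (fun i => canon_surj I (a i)) S).
Proof.
split; first exact: exists_maximal_unrelated.
move=> S maxS; have [SB unS _] := maxS; split.
- exact: (canon_surj_generators hB).
- split; first exact: (unrelated_lin_indep hB).
  exact: (maximal_unrelated_spanning hB).
- move=> _ /SB[[u Bu <-] _]; have [w ->] := smb_power_product hB Bu.
  exists w; rewrite rmorph_prod; apply: eq_bigr => p _; exact: rmorphXn.
- move=> _ _ /SB[[u Bu <-] _] /SB[[v Bv <-] _]; rewrite -rmorphM /=.
  have [->|[k [w [k0 Bw ->]]]] := smb_mul hB Bu Bv.
    by left; rewrite rmorph0.
  (* The monomial w may die in A; otherwise its image need not lie in S and is traded for a multiple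
     of a member of S. *)
  rewrite canon_surjZ; have [->|w0] := eqVneq (canon_surj I w) 0.
    by left; rewrite mulr0.
  right; have [|l [x [l0 Sx ->]]] := maximal_unrelated_cover maxS (y := canon_surj I w).
    by split; [exists w|exact/eqP].
  by exists (k * l), x; rewrite mulf_neq0// alg_scalarA.
Qed.
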